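(* Let $K$ be a field of characteristic different from $2$ and $3$ and let $L$ be a Lie superalgebra over $K$, regarded as an Akivis superalgebra with trilinear map $A=0$. Let $(\tilde U(L),\iota)$ be its universal enveloping superalgebra as an Akivis superalgebra and $(U(L),\sigma)$ its classical universal enveloping superalgebra. Then the unique superalgebra homomorphism $\tilde\sigma:\tilde U(L)\to U(L)$ with $\tilde\sigma\iota=\sigma$ is surjective, so that $$U(L)\simeq\tilde U(L)/\ker\tilde\sigma .$$
   Context: A superalgebra is a (not necessarily associative) $\mathbb{Z}_2$-graded algebra over $K$. Homomorphisms out of $\tilde U(L)$ are unital and of degree $0$ (parity preserving). Classical universal enveloping superalgebra: $U(L)$ is the quotient of the associative tensor superalgebra of $L$ by the two-sided ideal generated by $x\otimes y-(-1)^{\alpha\beta}y\otimes x-[x,y]$ for $x\in L_\alpha,y\in L_\beta$, and $\sigma:L\to U(L)$ is the canonical map. Universal enveloping superalgebra of $L$ as an Akivis superalgebra with $A=0$: let $\tilde T(L)=\bigoplus_{n\ge 0}\tilde T^n(L)$ be the nonassociative tensor algebra, $\tilde T^0(L)=K$, $\tilde T^1(L)=L$, $\tilde T^n(L)=\bigoplus_{i=1}^{n-1}\tilde T^i(L)\otimes\tilde T^{n-i}(L)$ for $n\ge2$, with multiplication $xy=x\otimes y$ (elements of $K$ acting by scalar multiplication) and the $\mathbb{Z}_2$-grading induced from $L$. Let $I$ be the two-sided ideal generated by $x\otimes y-(-1)^{\alpha\beta}y\otimes x-[x,y]$ and $(x\otimes y)\otimes z-x\otimes(y\otimes z)$ for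 homogeneous $x\in L_\alpha,y\in L_\beta,z\in L_\gamma$. Then $\tilde U(L)=\tilde T(L)/I$ and $\iota:L\to\tilde U(L)$ is the composition of the inclusion $L\subseteq\tilde T(L)$ with the quotient map. *)

(* Defs.v *)
From HB Require Import structures.
From mathcomp Require Import all_boot all_order all_algebra finmap.
From mathcomp Require Import boolp classical_sets functions cardinality.

Set Implicit Arguments.
Unset Strict Implicit.
Unset Printing Implicit Defensive.

Import GRing.Theory.
Local Open Scope classical_set_scope.
Local Open Scope ring_scope.

Notation bilinear_map := (bilinear_for *:%R *:%R).

Lemma lin0 (K : fieldType) (U V : lmodType K) (f : U -> V) : linear f -> f 0 = 0.
Proof. by move=> /(_ (-1) 0 0); rewrite scaler0 addr0 scaleN1r addNr. Qed.

Lemma linD (K : fieldType) (U V : lmodType K) (f : U -> V) :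
  linear f -> {morph f : x y / x + y}.
Proof. by move=> fL x y; have := fL 1 x y; rewrite !scale1r. Qed.

Section Submodules.
Context {K : fieldType} {V : lmodType K}.

Definition submod (P : set V) : Prop :=
  P 0 /\ forall a x y, P x -> P y -> P (a *: x + y).

Definition asbool_pred (P : set V) : V -> bool := fun x => `[< P x >].

Fact asbool_submod_closed (P : set V) : submod P -> submod_closed (asbool_pred P).
Proof.
case=> P0 PD; split=> [|a x y]; first exact/asboolP.
by rewrite !unfold_in => /asboolP Px /asboolP Py; apply/asboolP/PD.
Qed.

Definition submod_of (P : set V) (hP : submod P) : submodClosed V :=
  HB.pack_for (submodClosed V) (asbool_pred P)
    (GRing.isSubmodClosed.Build K V (asbool_pred P) (asbool_submod_closed hP)).

Lemma mem_submod_of (P : set V) (hP : submod P) x : (x \in submod_of hP) <-> P x.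
Proof. by split=> [/asboolP|h]; [|apply/asboolP]. Qed.

Fact span_submod (S : set V) :
  submod (fun x => forall N : submodClosed V, (forall y, S y -> y \in N) -> x \in N).
Proof.
split=> [N _|a x y Sx Sy N SN]; first exact: rpred0.
by apply: rpredD; [apply: rpredZ; apply: Sx | apply: Sy].
Qed.

Definition span (S : set V) : submodClosed V := submod_of (span_submod S).

Lemma mem_span (S : set V) x : S x -> x \in span S.
Proof. by move=> Sx; apply/mem_submod_of=> N; apply. Qed.

Lemma span_min (S : set V) (N : submodClosed V) x :
  (forall y, S y -> y \in N) -> x \in span S -> x \in N.
Proof. by move=> SN /mem_submod_of; apply. Qed.

Lemma span_ind (S P : set V) x :
  submod P -> (forall y, S y -> P y) -> x \in span S -> P x.
Proof.
move=> hP SP xS; apply/(mem_submod_of hP); apply: span_min xS => y Sy.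
exact/mem_submod_of/SP.
Qed.

End Submodules.

Section Quotient.
Context {K : fieldType} {V : lmodType K} (N : submodClosed V).

Fact submod_oppr_closed : oppr_closed (N : {pred V}).
Proof. by move=> x xN; rewrite -scaleN1r rpredZ. Qed.
Lemma rpredNsub x : x \in N -> - x \in N.
Proof. exact: submod_oppr_closed. Qed.

Fact submod_zmod_closed : zmod_closed (N : {pred V}).
Proof. by split=> [|x y xN yN]; rewrite ?rpred0 // rpredD ?submod_oppr_closed. Qed.
Definition submod_mem : V -> bool := fun x => x \in N.
Definition submod_zmod : zmodClosed V := HB.pack_for (zmodClosed V) submod_mem
  (GRing.isZmodClosed.Build V submod_mem submod_zmod_closed).
Definition lquot : Type := Quotient.quot submod_zmod.
HB.instance Definition _ := GRing.Zmodule.on lquot.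

Definition lproj (x : V) : lquot := (\pi_(Quotient.quot submod_zmod) x)%qT.
Definition lrepr (q : lquot) : V := generic_quotient.repr (q : Quotient.quot submod_zmod).

Lemma lreprK q : lproj (lrepr q) = q.
Proof. exact: generic_quotient.reprK. Qed.

Lemma lprojP x y : (lproj x = lproj y) <-> (x - y \in N).
Proof.
have e : (x - y \in N) = (lproj x == lproj y).
  exact: Quotient.idealrBE submod_zmod x y.
by rewrite e; split=> /eqP.
Qed.

Lemma lrepr_proj x : lrepr (lproj x) - x \in N.
Proof. by apply/lprojP; rewrite lreprK. Qed.

Lemma lprojD x y : lproj (x + y) = lproj x + lproj y.
Proof. exact: raddfD (\pi_(Quotient.quot submod_zmod))%qT x y. Qed.

Definition lquot_scale (a : K) (q : lquot) : lquot := lproj (a *: lrepr q).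

Lemma lprojZ a x : lproj (a *: x) = lquot_scale a (lproj x).
Proof.
apply/lprojP; rewrite -scalerBr rpredZ // -opprB rpredNsub //; exact: lrepr_proj.
Qed.

Fact lquot_scaleA a b q :
  lquot_scale a (lquot_scale b q) = lquot_scale (a * b) q.
Proof. by rewrite -(lreprK q) -!lprojZ scalerA. Qed.
Fact lquot_scale1 : left_id 1 lquot_scale.
Proof. by move=> q; rewrite -(lreprK q) -!lprojZ scale1r. Qed.
Fact lquot_scaleDr : right_distributive lquot_scale +%R.
Proof.
by move=> a p q; rewrite -(lreprK p) -(lreprK q) -!(lprojD, lprojZ) scalerDr.
Qed.
Fact lquot_scaleDl q : {morph lquot_scale^~ q : a b / a + b}.
Proof. by move=> a b /=; rewrite -(lreprK q) -!(lprojD, lprojZ) scalerDl. Qed.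

HB.instance Definition _ := GRing.Zmodule_isLmodule.Build K lquot
  lquot_scaleA lquot_scale1 lquot_scaleDr lquot_scaleDl.

Fact lproj_is_linear : linear lproj.
Proof. by move=> a x y; rewrite lprojD lprojZ. Qed.
HB.instance Definition _ := GRing.isLinear.Build K V lquot _ lproj lproj_is_linear.

Lemma lproj_eq0 x : (lproj x = 0) <-> (x \in N).
Proof. by rewrite -(linear0 lproj) lprojP subr0. Qed.

End Quotient.

(** Elements of the direct sum are the families of finite support. *)
Section DirectSum.
Context {K : fieldType} {I : choiceType} (V : I -> lmodType K).

Record dsum : Type := Dsum {
  dcoef :> forall i, V i;
  dcoef_fin : finite_set [set i | dcoef i != 0] }.

HB.instance Definition _ := gen_eqMixin dsum.
HB.instance Definition _ := gen_choiceMixin dsum.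

Lemma dsumP (f g : dsum) : (forall i, f i = g i) -> f = g.
Proof.
case: f g => f Hf [g Hg] /= fg.
have {}fg : f = g by apply: functional_extensionality_dep.
by case: _ / fg in Hg *; congr Dsum; apply: Prop_irrelevance.
Qed.

Fact dsum0_fin : finite_set [set i | (0 : V i) != 0].
Proof. by apply: (sub_finite_set (B := set0)) => // i /=; rewrite eqxx. Qed.
Definition dsum0 : dsum := Dsum dsum0_fin.

Fact dsusubmod_mem_fin (f : dsum) : finite_set [set i | - f i != 0].
Proof.
by apply: sub_finite_set (dcoef_fin f) => i /=; rewrite oppr_eq0.
Qed.
Definition dsusubmod_mem f : dsum := Dsum (dsusubmod_mem_fin f).

Fact dsumD_fin (f g : dsum) : finite_set [set i | f i + g i != 0].
Proof.
apply: (sub_finite_set (B := [set i | f i != 0] `|` [set i | g i != 0])).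
  move=> i /=; case: (eqVneq (f i) 0) => [->|]; last by left.
  by rewrite add0r; right.
by rewrite finite_setU; split; apply: dcoef_fin.
Qed.
Definition dsumD f g : dsum := Dsum (dsumD_fin f g).

Fact dsumZ_fin a (f : dsum) : finite_set [set i | a *: f i != 0].
Proof.
apply: sub_finite_set (dcoef_fin f) => i /=.
by apply: contra => /eqP->; rewrite scaler0.
Qed.
Definition dsumZ a f : dsum := Dsum (dsumZ_fin a f).

Fact dsumDA : associative dsumD.
Proof. by move=> f g h; apply: dsumP => i /=; rewrite addrA. Qed.
Fact dsumDC : commutative dsumD.
Proof. by move=> f g; apply: dsumP => i /=; rewrite addrC. Qed.
Fact dsum0D : left_id dsum0 dsumD.
Proof. by move=> f; apply: dsumP => i /=; rewrite add0r. Qed.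
Fact dsusubmod_memD : left_inverse dsum0 dsusubmod_mem dsumD.
Proof. by move=> f; apply: dsumP => i /=; rewrite addNr. Qed.

HB.instance Definition _ :=
  GRing.isZmodule.Build dsum dsumDA dsumDC dsum0D dsusubmod_memD.

Fact dsumZA a b f : dsumZ a (dsumZ b f) = dsumZ (a * b) f.
Proof. by apply: dsumP => i /=; rewrite scalerA. Qed.
Fact dsumZ1 : left_id 1 dsumZ.
Proof. by move=> f; apply: dsumP => i /=; rewrite scale1r. Qed.
Fact dsumZDr : right_distributive dsumZ +%R.
Proof. by move=> a f g; apply: dsumP => i /=; rewrite scalerDr. Qed.
Fact dsumZDl f : {morph dsumZ^~ f : a b / a + b}.
Proof. by move=> a b; apply: dsumP => i /=; rewrite scalerDl. Qed.

HB.instance Definition _ :=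
  GRing.Zmodule_isLmodule.Build K dsum dsumZA dsumZ1 dsumZDr dsumZDl.

Lemma dcoefD (f g : dsum) i : (f + g) i = f i + g i. Proof. by []. Qed.
Lemma dcoefZ a (f : dsum) i : (a *: f) i = a *: f i. Proof. by []. Qed.
Lemma dcoef0 i : (0 : dsum) i = 0. Proof. by []. Qed.

Lemma dcoef_sum (T : Type) (r : seq T) (P : pred T) (F : T -> dsum) i :
  (\sum_(t <- r | P t) F t) i = \sum_(t <- r | P t) F t i.
Proof. exact: (big_morph (fun f : dsum => f i)). Qed.

Definition dzero (i : I) : V i := 0.
Fact dinj_fin i (x : V i) : finite_set [set j | dfwith dzero x j != 0].
Proof.
apply: (sub_finite_set (B := [set i])); last exact: finite_set1.
by move=> j /=; case: dfwithP => //= k _; rewrite eqxx.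
Qed.
Definition dinj i (x : V i) : dsum := Dsum (dinj_fin x).
Arguments dinj : clear implicits.

Lemma dinj_is_linear i : linear (@dinj i).
Proof.
move=> a x y; apply: dsumP => j; rewrite dcoefD dcoefZ /=.
case: (eqVneq i j) => [e|ij].
  by case: _ / e; rewrite !dfwith_in.
by rewrite !dfwith_out // scaler0 addr0.
Qed.
HB.instance Definition _ i :=
  GRing.isLinear.Build K (V i) dsum _ (@dinj i) (@dinj_is_linear i).

Definition dsupp (f : dsum) : seq I :=
  enum_fset (fset_set [set i | f i != 0]).

Lemma mem_dsupp (f : dsum) i : (i \in dsupp f) = (f i != 0).
Proof.
have e := in_fset_set (dcoef_fin f) i.
by rewrite /dsupp -[LHS]/(i \in fset_set _) e; apply/idP/idP; rewrite inE.
Qed.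

Definition dlift (W : lmodType K) (phi : forall i, V i -> W) (f : dsum) : W :=
  \sum_(i <- dsupp f) phi i (f i).

Section Lift.
Context {W : lmodType K} (phi : forall i, V i -> W).
Arguments phi : clear implicits.
Hypothesis phiL : forall i, linear (phi i).
Arguments phiL : clear implicits.

Let phi0 i : phi i 0 = 0.
Proof. by have := phiL i (-1) 0 0; rewrite scaler0 addr0 scaleN1r addNr. Qed.

Lemma dliftE (f : dsum) (s : seq I) : uniq s -> {subset dsupp f <= s} ->
  dlift phi f = \sum_(i <- s) phi i (f i).
Proof.
move=> us fs; rewrite /dlift (bigID (fun i => f i != 0)) /=.
rewrite [X in _ + X]big1_seq ?addr0; last first.
  by move=> i /andP[/negPn/eqP-> _]; rewrite phi0.
rewrite [RHS](bigID (fun i => f i != 0)) /=.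
rewrite [X in _ = _ + X]big1_seq ?addr0; last first.
  by move=> i /andP[/negPn/eqP-> _]; rewrite phi0.
rewrite -!(big_filter _ (fun i => f i != 0)); apply: perm_big.
apply: uniq_perm; rewrite ?filter_uniq ?fset_uniq //.
move=> i; rewrite !mem_filter mem_dsupp; case: eqVneq => //= fi.
by rewrite fs // mem_dsupp.
Qed.

Lemma dlift_is_linear : linear (dlift phi).
Proof.
move=> a f g; pose s := undup (dsupp f ++ dsupp g ++ dsupp (a *: f + g)).
have us : uniq s by apply: undup_uniq.
rewrite !(@dliftE _ s) // => [|i|i|i]; rewrite ?mem_undup ?mem_cat;
  try by move=> ->; rewrite ?orbT.
by rewrite scaler_sumr -big_split; apply: eq_bigr => i _ /=; rewrite phiL.
Qed.

Lemma dlift_inj i x : dlift phi (dinj i x) = phi i x.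
Proof.
rewrite (@dliftE _ [:: i]) //; first by rewrite big_seq1 /= dfwith_in.
move=> j; rewrite mem_dsupp inE /=; case: dfwithP => [//|k _].
by rewrite eqxx.
Qed.
End Lift.

Lemma dsum_decomp (f : dsum) : f = \sum_(i <- dsupp f) dinj i (f i).
Proof.
apply: dsumP => j; rewrite dcoef_sum.
have [jf|jf] := boolP (j \in dsupp f).
  rewrite (bigD1_seq j) ?fset_uniq //= dfwith_in big1 ?addr0 //.
  by move=> i ij; rewrite dfwith_out.
rewrite big1_seq => [|i /andP[_ fi]].
  by apply/eqP; move: jf; rewrite mem_dsupp negbK.
by rewrite /= dfwith_out //; apply: contraNneq jf => <-.
Qed.

Lemma dsum_ind (P : dsum -> Prop) : P 0 -> (forall f g, P f -> P g -> P (f + g)) ->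
  (forall i x, P (dinj i x)) -> forall f, P f.
Proof. by move=> P0 PD Pi f; rewrite (dsum_decomp f); apply: big_ind. Qed.

End DirectSum.
Arguments dinj {K I V} i x.

(** V (x) W is the free vector space on V * W modulo the bilinearity relations. *)
Section Tensor.
Context {K : fieldType} (V W : lmodType K).

Definition free_prod := dsum (fun _ : V * W => K^o : lmodType K).
HB.instance Definition _ := GRing.Lmodule.on free_prod.

Definition fgen (v : V) (w : W) : free_prod :=
  dinj (V := fun _ : V * W => K^o : lmodType K) (v, w) (1 : K).

Definition tensor_rel : set free_prod := fun r =>
  (exists a v v' w, r = fgen (a *: v + v') w - (a *: fgen v w + fgen v' w)) \/
  (exists a v w w', r = fgen v (a *: w + w') - (a *: fgen v w + fgen v w')).

Definition tensor : Type := lquot (span tensor_rel).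
HB.instance Definition _ := GRing.Lmodule.on tensor.

Definition tens (v : V) (w : W) : tensor := lproj (span tensor_rel) (fgen v w).

Lemma tens_bilinear : bilinear_map tens.
Proof.
split=> [w a v v'|v a w w'] /=; rewrite /tens -linearP; apply/lprojP;
  apply: mem_span; [left | right].
  by exists a, v, v', w.
by exists a, v, w, w'.
Qed.

Lemma tensor_ind (P : tensor -> Prop) : P 0 ->
  (forall x y, P x -> P y -> P (x + y)) -> (forall v w, P (tens v w)) ->
  forall t, P t.
Proof.
move=> P0 PD Pt t; rewrite -(lreprK t).
move: (lrepr t) => r.
apply: (@dsum_ind K _ (fun _ : V * W => K^o : lmodType K)
          (fun r => P (lproj (span tensor_rel) r)) _ _ _ r) => {t r}.
- by rewrite linear0.
- by move=> f g Pf Pg; rewrite linearD; apply: PD.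
move=> [v w] a.
have -> : dinj (V := fun _ : V * W => K^o : lmodType K) (v, w) a = a *: fgen v w.
  by rewrite -linearZ; congr (dinj (V := fun _ => _) _ _); rewrite /GRing.scale /= mulr1.
rewrite linearZ; change (P (a *: tens v w)).
have := tens_bilinear.1 w a v 0; rewrite /= addr0 => h.
have := tens_bilinear.1 w (-1) 0 0; rewrite /= scaler0 addr0 scaleN1r addNr => h0.
by rewrite h0 addr0 in h; rewrite -h.
Qed.

Definition tlift (X : lmodType K) (f : V -> W -> X) (t : tensor) : X :=
  dlift (fun (p : V * W) (a : K^o) => (a : K) *: f p.1 p.2) (lrepr t).

Section Lift.
Context {X : lmodType K} (f : V -> W -> X).
Hypothesis fB : bilinear_map f.
Arguments fB : clear implicits.

Let flift (r : free_prod) : X :=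
  dlift (fun (p : V * W) (a : K^o) => (a : K) *: f p.1 p.2) r.
Let flift_linear : linear flift.
Proof.
by apply: dlift_is_linear => p a x y /=; rewrite scalerDl scalerA.
Qed.
HB.instance Definition _ := GRing.isLinear.Build K free_prod X _ flift flift_linear.

Let flift_gen v w : flift (fgen v w) = f v w.
Proof.
rewrite /flift /fgen dlift_inj ?scale1r // => p a x y /=.
by rewrite scalerDl scalerA.
Qed.

Let flift_ker r : r \in span tensor_rel -> flift r = 0.
Proof.
apply: (span_ind (P := fun r => flift r = 0)).
  split=> [|a x y x0 y0]; first exact: linear0.
  by rewrite linearP /= x0 y0 scaler0 addr0.
move=> y [[a [v [v' [w ->]]]]|[a [v [w [w' ->]]]]];
  rewrite linearB linearP /= !flift_gen.
  by have := fB.1 w a v v'; rewrite /= => ->; rewrite subrr.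
by have := fB.2 v a w w'; rewrite /= => ->; rewrite subrr.
Qed.

Let tlift_proj r : tlift f (lproj _ r) = flift r.
Proof.
have /flift_ker : lrepr (lproj (span tensor_rel) r) - r \in span tensor_rel.
  exact: lrepr_proj.
by rewrite linearB => /eqP; rewrite subr_eq0 => /eqP.
Qed.

Lemma tlift_is_linear : linear (tlift f).
Proof.
move=> a x y; rewrite -(lreprK x) -(lreprK y) -linearP.
by rewrite [LHS]tlift_proj !tlift_proj linearP.
Qed.

Lemma tlift_tens v w : tlift f (tens v w) = f v w.
Proof. by rewrite [LHS]tlift_proj flift_gen. Qed.
End Lift.

End Tensor.

(** [grading P] says that V is the direct sum of P false and P true. Parities
    are booleans (0 = false, 1 = true), added by [addb]; thus the sign
    (-1)^(ab) is [(-1) ^+ (a && b)]. *)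
Section Grading.
Context {K : fieldType}.

Definition grading (V : lmodType K) (P : bool -> set V) : Prop :=
  [/\ forall a, submod (P a),
      forall x, exists x0 x1, [/\ P false x0, P true x1 & x = x0 + x1]
    & forall x, P false x -> P true x -> x = 0].

Lemma grading_of_proj (V : lmodType K) (P : bool -> set V) (p : bool -> V -> V) :
  (forall a, submod (P a)) -> (forall a x, P a (p a x)) ->
  (forall x, x = p false x + p true x) ->
  (forall a x, P a x -> p (~~ a) x = 0) -> grading P.
Proof.
move=> PS Pp psum p0; split=> // x.
  by exists (p false x), (p true x).
by move=> /p0 /= x1 /p0 /= x0; rewrite (psum x) x1 x0 addr0.
Qed.
End Grading.

Record superspace (K : fieldType) := Superspace {
  superspace_sort :> lmodType K;
  homog : bool -> set superspace_sort;
  homogP : grading homog }.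
Arguments homog {K s} a x : rename.

Section Components.
Context {K : fieldType} {V : superspace K}.
Implicit Types x y : V.

Lemma homog_submod a : submod (@homog K V a).
Proof. by case: (homogP V). Qed.

Lemma homog0 a : homog a (0 : V).
Proof. by case: (homog_submod a). Qed.
Lemma homogP2 a (c : K) x y : homog a x -> homog a y -> homog a (c *: x + y).
Proof. by case: (homog_submod a) => _; apply. Qed.
Lemma homogD a x y : homog a x -> homog a y -> homog a (x + y).
Proof. by move=> hx hy; rewrite -[x]scale1r; apply: homogP2. Qed.
Lemma homogZ a (c : K) x : homog a x -> homog a (c *: x).
Proof. by move=> hx; rewrite -[c *: x]addr0; apply: homogP2 => //; apply: homog0. Qed.
Lemma homogN a x : homog a x -> homog a (- x).
Proof. by rewrite -scaleN1r; apply: homogZ. Qed.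
Lemma homogB a x y : homog a x -> homog a y -> homog a (x - y).
Proof. by move=> hx hy; apply: homogD => //; apply: homogN. Qed.
Lemma homog_direct x : homog false x -> homog true x -> x = 0.
Proof. by case: (homogP V) => _ _; apply. Qed.

Fact scomp_ex x : exists p : V * V, [/\ homog false p.1, homog true p.2 & x = p.1 + p.2].
Proof. by case: (homogP V) => _ /(_ x) [x0 [x1 h]] _; exists (x0, x1). Qed.

Definition scomp (a : bool) x : V :=
  let p := projT1 (cid (scomp_ex x)) in if a then p.2 else p.1.
Arguments scomp : simpl never.

Lemma scomp_homog a x : homog a (scomp a x).
Proof. by rewrite /scomp; case: cid => p [] /=; case: a. Qed.

Lemma scomp_sum x : x = scomp false x + scomp true x.
Proof. by rewrite /scomp; case: cid => p []. Qed.

Lemma scomp_uniq x0 x1 : homog false x0 -> homog true x1 ->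
  scomp false (x0 + x1) = x0 /\ scomp true (x0 + x1) = x1.
Proof.
move=> h0 h1; set x := x0 + x1; have e := scomp_sum x.
have d : scomp false x - x0 = x1 - scomp true x.
  by apply/eqP; rewrite subr_eq addrAC eq_sym subr_eq -e addrC.
have d0 : scomp false x - x0 = 0.
  apply: homog_direct; first by apply: homogB => //; apply: scomp_homog.
  by rewrite d; apply: homogB => //; apply: scomp_homog.
split; first by apply/eqP; rewrite -subr_eq0 d0.
by apply/eqP; rewrite eq_sym -subr_eq0 -d d0.
Qed.

Lemma scomp_id a x : homog a x -> scomp a x = x.
Proof.
case: a => hx.
  by have [_] := scomp_uniq (homog0 false) hx; rewrite add0r.
by have [] := scomp_uniq hx (homog0 true); rewrite addr0.
Qed.

Lemma scomp_neg a x : homog a x -> scomp (~~ a) x = 0.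
Proof.
case: a => hx.
  by have [] := scomp_uniq (homog0 false) hx; rewrite add0r.
by have [_] := scomp_uniq hx (homog0 true); rewrite addr0.
Qed.

Lemma scomp_linear a : linear (scomp a).
Proof.
move=> c x y; have e : c *: x + y =
    (c *: scomp false x + scomp false y) + (c *: scomp true x + scomp true y).
  by rewrite addrACA -scalerDr -!scomp_sum.
have [h0 h1] := scomp_uniq
  (homogP2 c (scomp_homog false x) (scomp_homog false y))
  (homogP2 c (scomp_homog true x) (scomp_homog true y)).
by rewrite {1}e; case: a.
Qed.
HB.instance Definition _ a := GRing.isLinear.Build K V V _ (scomp a) (scomp_linear a).

End Components.
Arguments scomp : simpl never.

Section Scalars.
Variable K : fieldType.

Definition scalar_homog (a : bool) : set K^o := fun x => a -> x = 0.

Fact scalar_grading : grading (scalar_homog : bool -> set (K^o : lmodType K)).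
Proof.
apply: (grading_of_proj (p := fun a x => if a then 0 else x)).
- move=> a; split=> [//|c x y hx hy /[dup] /hx -> /hy ->].
  by rewrite scaler0 addr0.
- by case.
- by move=> x; rewrite addr0.
by case=> x //= ->.
Qed.

Definition scalar_superspace : superspace K := Superspace scalar_grading.
End Scalars.

Section DirectSumGrading.
Context {K : fieldType} {I : choiceType} (V : I -> superspace K).

Definition dsum_homog (a : bool) : set (dsum V) := fun f => forall i, homog a (f i).

Fact dsum_scomp_fin a (f : dsum V) : finite_set [set i | scomp a (f i) != 0].
Proof.
apply: sub_finite_set (dcoef_fin f) => i /=.
by apply: contra => /eqP->; rewrite linear0.
Qed.

Fact dsum_grading : grading dsum_homog.
Proof.
apply: (grading_of_proj (p := fun a f => Dsum (dsum_scomp_fin a f))).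
- by move=> a; split=> [i|c f g hf hg i]; [apply: homog0 | apply: homogP2].
- by move=> a f i; apply: scomp_homog.
- by move=> f; apply: dsumP => i /=; apply: scomp_sum.
by move=> a f hf; apply: dsumP => i /=; apply: scomp_neg.
Qed.

Definition ssum : superspace K := Superspace dsum_grading.

Lemma dinj_homog a i (x : V i) : homog a x -> homog a (dinj i x : ssum).
Proof.
by move=> hx j /=; case: dfwithP => [//|k _]; apply: homog0.
Qed.
End DirectSumGrading.

Section TensorGrading.
Context {K : fieldType} (V W : superspace K).

Definition tensor_homog (c : bool) : set (tensor V W) := fun t =>
  t \in span [set s | exists a b v w,
    [/\ homog a v, homog b w, a (+) b = c & s = tens v w]].

Let q (c : bool) (v : V) (w : W) : tensor V W :=
  tens (scomp false v) (scomp c w) + tens (scomp true v) (scomp (~~ c) w).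

Let q_bilinear c : bilinear_map (q c).
Proof.
split=> [w a v v'|v a w w'] /=; rewrite /q !linearP /=.
  have h b := (tens_bilinear V W).1 (scomp b w) a; rewrite /= in h.
  by rewrite !h scalerDr addrACA.
have h b := (tens_bilinear V W).2 (scomp b v) a; rewrite /= in h.
by rewrite !h scalerDr addrACA.
Qed.

Fact tensor_grading : grading tensor_homog.
Proof.
have qL c := tlift_is_linear (q_bilinear c).
have qT c := tlift_tens (q_bilinear c).
have q0 c : tlift (q c) 0 = 0.
  by exact: lin0 (qL c).
have qD c x y : tlift (q c) (x + y) = tlift (q c) x + tlift (q c) y.
  by have := qL c 1 x y; rewrite !scale1r.
have PS c : submod (tensor_homog c).
  split=> [|a x y hx hy]; first exact: rpred0.
  by apply: rpredD => //; apply: rpredZ.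
have t0v (w : W) : tens (0 : V) w = 0.
  have := (tens_bilinear V W).1 w (-1) 0 0.
  by rewrite /= scaler0 addr0 scaleN1r addNr.
have t0w (v : V) : tens v (0 : W) = 0.
  have := (tens_bilinear V W).2 v (-1) 0 0.
  by rewrite /= scaler0 addr0 scaleN1r addNr.
have tDv (v v' : V) (w : W) : tens (v + v') w = tens v w + tens v' w.
  by have := (tens_bilinear V W).1 w 1 v v'; rewrite /= !scale1r.
have tDw (v : V) (w w' : W) : tens v (w + w') = tens v w + tens v w'.
  by have := (tens_bilinear V W).2 v 1 w w'; rewrite /= !scale1r.
apply: (grading_of_proj (p := fun c => tlift (q c))) => //.
- move=> c; apply: tensor_ind => [|x y hx hy|v w].
  + by rewrite q0; case: (PS c).
  + by rewrite qD; apply: rpredD.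
  rewrite qT; apply: rpredD; apply: mem_span.
    exists false, c, (scomp false v), (scomp c w).
    by split=> //; apply: scomp_homog.
  exists true, (~~ c), (scomp true v), (scomp (~~ c) w).
  by split; rewrite ?negbK //; [apply: scomp_homog | apply: scomp_homog | case: c].
- apply: tensor_ind => [|x y hx hy|v w]; first by rewrite !q0 addr0.
    by rewrite !qD {1}hx {1}hy addrACA.
  rewrite !qT /q /= addrACA -!tDw -[scomp true w + _]addrC -!scomp_sum.
  by rewrite -tDv -scomp_sum.
move=> c t; apply: (span_ind (P := fun t => tlift (q (~~ c)) t = 0)).
  split=> [|a x y hx hy]; first exact: q0.
  by rewrite qL hx hy scaler0 addr0.
move=> _ [a [b [v [w [hv hw <- ->]]]]]; rewrite qT /q.
case: a hv => hv /=.
  by rewrite (scomp_neg hv) t0v add0r !negbK (scomp_neg hw) t0w.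
by rewrite (scomp_neg hw) t0w (scomp_neg hv) t0v addr0.
Qed.

Definition stensor : superspace K := Superspace tensor_grading.
End TensorGrading.

Section QuotientGrading.
Context {K : fieldType} {V : superspace K} (N : submodClosed V).

Definition graded_sub : Prop := forall x0 x1 : V,
  homog false x0 -> homog true x1 -> x0 + x1 \in N -> x0 \in N /\ x1 \in N.

Definition quot_homog (a : bool) : set (lquot N) :=
  fun q => exists x, homog a x /\ q = lproj N x.

Fact quot_grading : graded_sub -> grading quot_homog.
Proof.
move=> gN; split.
- move=> a; split; first by exists 0; split; [apply: homog0 | rewrite linear0].
  move=> c _ _ [x [hx ->]] [y [hy ->]]; exists (c *: x + y).
  by split; [apply: homogP2 | rewrite linearP].
- move=> p; rewrite -(lreprK p) [lrepr p]scomp_sum.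
  set x0 := scomp _ _; set x1 := scomp _ _.
  exists (lproj N x0), (lproj N x1); split; last exact: linearD.
    by exists x0; split=> //; apply: scomp_homog.
  by exists x1; split=> //; apply: scomp_homog.
move=> p [x [hx ->]] [y [hy /lprojP xy]].
by have [xN _] := gN _ _ hx (homogN hy) xy; apply/lproj_eq0.
Qed.

Definition squot (gN : graded_sub) : superspace K := Superspace (quot_grading gN).
End QuotientGrading.

Record superalgebra (K : fieldType) := Superalgebra {
  superalgebra_space :> superspace K;
  smul : superalgebra_space -> superalgebra_space -> superalgebra_space;
  smul_bilinear : bilinear_map smul;
  smul_homog : forall a b x y, homog a x -> homog b y -> homog (a (+) b) (smul x y) }.
Arguments smul {K s} x y : rename.

Record unital_superalgebra (K : fieldType) := UnitalSuperalgebra {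
  unital_alg :> superalgebra K;
  sone : unital_alg;
  smul1x : forall x, smul sone x = x;
  smulx1 : forall x, smul x sone = x }.
Arguments sone {K u} : rename.

(** The bracket [x, y] is [smul x y]. *)
Record lie_superalgebra (K : fieldType) := LieSuperalgebra {
  lie_alg :> superalgebra K;
  lie_skew : forall (a b : bool) (x y : lie_alg), homog a x -> homog b y ->
    smul x y = - ((-1) ^+ (a && b) *: smul y x);
  lie_jacobi : forall (a b c : bool) (x y z : lie_alg),
    homog a x -> homog b y -> homog c z ->
    (-1) ^+ (a && c) *: smul x (smul y z) + (-1) ^+ (b && a) *: smul y (smul z x)
      + (-1) ^+ (c && b) *: smul z (smul x y) = 0 }.

Section SmulTheory.
Context {K : fieldType} {A : superalgebra K}.
Implicit Types x y z : A.

Lemma smulPl c x y z : smul (c *: x + y) z = c *: smul x z + smul y z.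
Proof. exact: (smul_bilinear A).1. Qed.
Lemma smulPr c x y z : smul z (c *: x + y) = c *: smul z x + smul z y.
Proof. exact: (smul_bilinear A).2. Qed.
Lemma smulDl x y z : smul (x + y) z = smul x z + smul y z.
Proof. by have := smulPl 1 x y z; rewrite !scale1r. Qed.
Lemma smulDr x y z : smul z (x + y) = smul z x + smul z y.
Proof. by have := smulPr 1 x y z; rewrite !scale1r. Qed.
Lemma smul0l z : smul 0 z = 0.
Proof. by have := smulPl (-1) 0 0 z; rewrite scaler0 addr0 scaleN1r addNr. Qed.
Lemma smul0r z : smul z 0 = 0.
Proof. by have := smulPr (-1) 0 0 z; rewrite scaler0 addr0 scaleN1r addNr. Qed.
Lemma smulZl c x z : smul (c *: x) z = c *: smul x z.
Proof. by have := smulPl c x 0 z; rewrite smul0l !addr0. Qed.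
Lemma smulZr c x z : smul z (c *: x) = c *: smul z x.
Proof. by have := smulPr c x 0 z; rewrite smul0r !addr0. Qed.
Lemma smulNl x z : smul (- x) z = - smul x z.
Proof. by rewrite -!scaleN1r smulZl. Qed.
Lemma smulNr x z : smul z (- x) = - smul z x.
Proof. by rewrite -!scaleN1r smulZr. Qed.
Lemma smulBl x y z : smul (x - y) z = smul x z - smul y z.
Proof. by rewrite smulDl smulNl. Qed.
Lemma smulBr x y z : smul z (x - y) = smul z x - smul z y.
Proof. by rewrite smulDr smulNr. Qed.
End SmulTheory.

Record ideal (K : fieldType) (A : superalgebra K) := Ideal {
  ideal_sub :> submodClosed A;
  idealMl : forall a x : A, x \in ideal_sub -> smul a x \in ideal_sub;
  idealMr : forall a x : A, x \in ideal_sub -> smul x a \in ideal_sub }.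

Section GeneratedIdeal.
Context {K : fieldType} {A : superalgebra K} (S : set A).

Fact ideal_gen_submod :
  submod (fun x => forall J : ideal A, (forall y, S y -> y \in J) -> x \in J).
Proof.
split=> [J _|c x y Sx Sy J SJ]; first exact: rpred0.
by apply: rpredD; [apply: rpredZ; apply: Sx | apply: Sy].
Qed.

Fact ideal_genMl (a x : A) :
  x \in submod_of ideal_gen_submod -> smul a x \in submod_of ideal_gen_submod.
Proof.
move=> /mem_submod_of Sx; apply/mem_submod_of => J SJ.
by apply: idealMl; apply: Sx.
Qed.

Fact ideal_genMr (a x : A) :
  x \in submod_of ideal_gen_submod -> smul x a \in submod_of ideal_gen_submod.
Proof.
move=> /mem_submod_of Sx; apply/mem_submod_of => J SJ.
by apply: idealMr; apply: Sx.
Qed.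

Definition ideal_gen : ideal A := Ideal ideal_genMl ideal_genMr.

Lemma mem_ideal_gen x : S x -> x \in ideal_gen.
Proof. by move=> Sx; apply/mem_submod_of=> J; apply. Qed.

Lemma ideal_gen_min (J : ideal A) x :
  (forall y, S y -> y \in J) -> x \in ideal_gen -> x \in J.
Proof. by move=> SJ /mem_submod_of; apply. Qed.

Hypothesis S_homog : forall x, S x -> exists a, homog a x.

Let comps (x : A) : Prop := forall a, scomp a x \in ideal_gen.

Let comps_submod : submod comps.
Proof.
split=> [a|c x y hx hy a]; first by rewrite linear0 rpred0.
by rewrite linearP; apply: rpredD; [apply: rpredZ; apply: hx | apply: hy].
Qed.

Let scomp_smul a (x y : A) : scomp a (smul x y) =
  smul (scomp false x) (scomp a y) + smul (scomp true x) (scomp (~~ a) y).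
Proof.
have h b c : homog (b (+) c) (smul (scomp b x) (scomp c y)).
  by apply: smul_homog; apply: scomp_homog.
have e : smul x y =
    (smul (scomp false x) (scomp false y) + smul (scomp true x) (scomp true y)) +
    (smul (scomp false x) (scomp true y) + smul (scomp true x) (scomp false y)).
  rewrite {1}(scomp_sum x) {1}(scomp_sum y) smulDl !smulDr.
  by rewrite [X in _ + X = _]addrC addrACA.
have [e0 e1] := scomp_uniq (homogD (h false false) (h true true))
                            (homogD (h false true) (h true false)).
by rewrite e; case: a; [exact: e1 | exact: e0].
Qed.

Let comps_idealMl (a x : A) :
  x \in submod_of comps_submod -> smul a x \in submod_of comps_submod.
Proof.
move=> /mem_submod_of hx; apply/mem_submod_of => c.
by rewrite scomp_smul; apply: rpredD; apply: idealMl; apply: hx.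
Qed.

Let comps_idealMr (a x : A) :
  x \in submod_of comps_submod -> smul x a \in submod_of comps_submod.
Proof.
move=> /mem_submod_of hx; apply/mem_submod_of => c.
by rewrite scomp_smul; apply: rpredD; apply: idealMr; apply: hx.
Qed.

Lemma ideal_gen_graded : graded_sub ideal_gen.
Proof.
move=> x0 x1 h0 h1 /(ideal_gen_min (J := Ideal comps_idealMl comps_idealMr)).
have sub y : S y -> y \in Ideal comps_idealMl comps_idealMr.
  move=> Sy; apply/mem_submod_of => b; have [a hy] := S_homog Sy.
  have [->|nab] := eqVneq b a; first by rewrite scomp_id ?mem_ideal_gen.
  have -> : b = ~~ a by case: a b nab {hy} => [] [].
  by rewrite scomp_neg ?rpred0.
move=> /(_ sub) /mem_submod_of h; have [e0 e1] := scomp_uniq h0 h1.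
by have := h false; have := h true; rewrite e0 e1.
Qed.

End GeneratedIdeal.

Section QuotientAlgebra.
Context {K : fieldType} {A : unital_superalgebra K} (J : ideal A) (gJ : graded_sub J).

Definition quot_mul (p q : squot gJ) : squot gJ := lproj J (smul (lrepr p) (lrepr q)).

Lemma quot_mul_proj (x y : A) : quot_mul (lproj J x) (lproj J y) = lproj J (smul x y).
Proof.
apply/lprojP.
rewrite -[smul _ (lrepr _)](subrK (smul x (lrepr (lproj J y)))) -addrA.
rewrite -smulBl -smulBr; apply: rpredD.
  by apply: idealMr; apply: lrepr_proj.
by apply: idealMl; apply: lrepr_proj.
Qed.

Fact quot_mul_bilinear : bilinear_map quot_mul.
Proof.
split=> [r c p q|r c p q] /=;
  rewrite -(lreprK p) -(lreprK q) -(lreprK r) -linearP !quot_mul_proj -linearP.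
  by rewrite smulPl.
by rewrite smulPr.
Qed.

Fact quot_mul_homog a b (p q : squot gJ) :
  homog a p -> homog b q -> homog (a (+) b) (quot_mul p q).
Proof.
move=> [x [hx ->]] [y [hy ->]]; exists (smul x y).
by split; [apply: smul_homog | rewrite quot_mul_proj].
Qed.

Fact quot_mul1x (p : squot gJ) : quot_mul (lproj J sone) p = p.
Proof. by rewrite -(lreprK p) quot_mul_proj smul1x. Qed.
Fact quot_mulx1 (p : squot gJ) : quot_mul p (lproj J sone) = p.
Proof. by rewrite -(lreprK p) quot_mul_proj smulx1. Qed.

Definition quot_alg : unital_superalgebra K :=
  @UnitalSuperalgebra K (Superalgebra quot_mul_bilinear quot_mul_homog)
    (lproj J sone) quot_mul1x quot_mulx1.

Definition quot_map (x : A) : quot_alg := lproj J x.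
End QuotientAlgebra.

(** Homomorphisms are unital and of degree 0. *)
Record superhom (K : fieldType) (A B : unital_superalgebra K) := Superhom {
  superhom_fun :> A -> B;
  superhom_linear : linear superhom_fun;
  superhom_mul : forall x y, superhom_fun (smul x y) = smul (superhom_fun x) (superhom_fun y);
  superhom_one : superhom_fun sone = sone;
  superhom_homog : forall a x, homog a x -> homog a (superhom_fun x) }.

Section Kernel.
Context {K : fieldType} {A B : unital_superalgebra K} (f : superhom A B).
HB.instance Definition _ :=
  GRing.isLinear.Build K A B _ (superhom_fun f) (superhom_linear f).

Fact ker_submod : submod (fun x => f x = 0).
Proof.
split=> [|c x y fx fy]; first exact: linear0.
by rewrite linearP /= fx fy scaler0 addr0.
Qed.

Fact ker_idealMl (a x : A) : x \in submod_of ker_submod -> smul a x \in submod_of ker_submod.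
Proof.
by move=> /mem_submod_of fx; apply/mem_submod_of; rewrite superhom_mul fx smul0r.
Qed.
Fact ker_idealMr (a x : A) : x \in submod_of ker_submod -> smul x a \in submod_of ker_submod.
Proof.
by move=> /mem_submod_of fx; apply/mem_submod_of; rewrite superhom_mul fx smul0l.
Qed.

Definition ker : ideal A := Ideal ker_idealMl ker_idealMr.

Lemma ker_graded : graded_sub ker.
Proof.
move=> x0 x1 h0 h1 /mem_submod_of; rewrite linearD /= => e.
have f0 : f x0 = 0.
  apply: homog_direct; first exact: superhom_homog.
  rewrite (_ : f x0 = - f x1); last by apply/eqP; rewrite -addr_eq0; apply/eqP.
  by apply: homogN; apply: superhom_homog.
by split; apply/(mem_submod_of ker_submod); rewrite // -e f0 add0r.
Qed.
End Kernel.
Arguments ker_graded {K A B} f [x0 x1] _ _ _.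

Definition superalg_iso (K : fieldType) (A B : unital_superalgebra K) : Prop :=
  exists f : superhom A B, bijective f.

(** The direct sum of the T n, multiplied through mu : T^m x T^n -> T^(m+n);
    mu need not be associative. *)
Section GradedAlgebra.
Context {K : fieldType} (T : nat -> superspace K).
Variable mu : forall m n, T m -> T n -> T (m + n)%N.
Arguments mu : clear implicits.
Hypothesis muB : forall m n, bilinear_map (mu m n).
Arguments muB : clear implicits.
Hypothesis muH : forall m n a b (x : T m) (y : T n),
  homog a x -> homog b y -> homog (a (+) b) (mu m n x y).

Definition gmul (f g : ssum T) : ssum T :=
  dlift (fun m x => dlift (fun n y => dinj (m + n)%N (mu m n x y)) g) f.

Let inL m (x : T m) n : linear (fun y => dinj (V := T) (m + n)%N (mu m n x y)).
Proof.
move=> c y y'; have /= -> := (muB m n).2 x c y y'.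
exact: linearP.
Qed.

Let outL (g : ssum T) m :
  linear (fun x : T m => dlift (fun n y => dinj (V := T) (m + n)%N (mu m n x y)) g).
Proof.
move=> c x x'; rewrite /dlift scaler_sumr -big_split; apply: eq_bigr => n _ /=.
by have /= -> := (muB m n).1 (g n) c x x'; exact: linearP.
Qed.

Fact gmul_bilinear : bilinear_map gmul.
Proof.
split=> [g c f f'|f c g g'] /=; first by rewrite /gmul dlift_is_linear.
have E h : gmul f h = \sum_(m <- dsupp f)
    dlift (fun n y => dinj (V := T) (m + n)%N (mu m n (f m) y)) h by [].
rewrite !E scaler_sumr -big_split; apply: eq_bigr => m _.
by rewrite dlift_is_linear.
Qed.

Lemma gmul_inj m n (x : T m) (y : T n) :
  gmul (dinj m x) (dinj n y) = dinj (m + n)%N (mu m n x y).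
Proof. by rewrite /gmul dlift_inj // dlift_inj. Qed.

Fact gmul_homog a b (f g : ssum T) :
  homog a f -> homog b g -> homog (a (+) b) (gmul f g).
Proof.
move=> hf hg; rewrite /gmul /dlift.
apply: (big_ind (fun h : ssum T => homog (a (+) b) h)) => [||m _].
- exact: homog0.
- by move=> *; apply: homogD.
apply: (big_ind (fun h : ssum T => homog (a (+) b) h)) => [||n _].
- exact: homog0.
- by move=> *; apply: homogD.
by apply: dinj_homog; apply: muH.
Qed.

Variable e : T 0%N.
Hypothesis mu1x : forall n (y : T n), mu 0%N n e y = y.
Hypothesis mux1 : forall m (x : T m), dinj (V := T) (m + 0)%N (mu m 0%N x e) = dinj m x.

Let gmulDl (f f' g : ssum T) : gmul (f + f') g = gmul f g + gmul f' g.
Proof. by have := gmul_bilinear.1 g 1 f f'; rewrite /= !scale1r. Qed.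
Let gmulDr (f g g' : ssum T) : gmul f (g + g') = gmul f g + gmul f g'.
Proof. by have := gmul_bilinear.2 f 1 g g'; rewrite /= !scale1r. Qed.

Fact gmul1x (f : ssum T) : gmul (dinj 0%N e) f = f.
Proof.
move: f; apply: (@dsum_ind K nat T (fun f => gmul (dinj 0%N e) f = f)) => [|f g hf hg|n y].
- by have := gmul_bilinear.2 (dinj 0%N e) (-1) 0 0; rewrite /= scaler0 addr0 scaleN1r addNr.
- by rewrite gmulDr hf hg.
by rewrite gmul_inj mu1x.
Qed.

Fact gmulx1 (f : ssum T) : gmul f (dinj 0%N e) = f.
Proof.
move: f; apply: (@dsum_ind K nat T (fun f => gmul f (dinj 0%N e) = f)) => [|f g hf hg|n y].
- by have := gmul_bilinear.1 (dinj 0%N e) (-1) 0 0; rewrite /= scaler0 addr0 scaleN1r addNr.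
- by rewrite gmulDl hf hg.
by rewrite gmul_inj mux1.
Qed.

Lemma gmulA :
  (forall m n p (x : T m) (y : T n) (z : T p),
     dinj (V := T) (m + (n + p))%N (mu m (n + p)%N x (mu n p y z)) =
     dinj (V := T) (m + n + p)%N (mu (m + n)%N p (mu m n x y) z)) ->
  associative gmul.
Proof.
move=> muA f g h.
have z0 f' : gmul 0 f' = 0 := lin0 (gmul_bilinear.1 f').
have z0' f' : gmul f' 0 = 0 := lin0 (gmul_bilinear.2 f').
move: f; apply: (@dsum_ind K nat T (fun f => gmul f (gmul g h) = gmul (gmul f g) h)).
- by rewrite !z0.
- by move=> f1 f2 h1 h2; rewrite !gmulDl h1 h2.
move=> m x; move: g.
apply: (@dsum_ind K nat T
  (fun g => gmul (dinj m x) (gmul g h) = gmul (gmul (dinj m x) g) h)).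
- by rewrite ?(z0, z0').
- by move=> f1 f2 h1 h2; rewrite gmulDl !gmulDr gmulDl h1 h2.
move=> n y; move: h; apply: (@dsum_ind K nat T (fun h =>
  gmul (dinj m x) (gmul (dinj n y) h) = gmul (gmul (dinj m x) (dinj n y)) h)).
- by rewrite !z0'.
- by move=> f1 f2 h1 h2; rewrite !gmulDr h1 h2.
by move=> p z; rewrite !gmul_inj muA.
Qed.

Definition graded_alg : unital_superalgebra K :=
  @UnitalSuperalgebra K (Superalgebra gmul_bilinear gmul_homog)
    (dinj 0%N e) gmul1x gmulx1.

End GradedAlgebra.

Fact scale_bilinear (K : fieldType) (V : lmodType K) :
  bilinear_map (fun (c : (K^o : lmodType K)) (y : V) => (c : K) *: y).
Proof.
split=> [y c a b|a c y y'] /=; last by rewrite scalerDr !scalerA (mulrC (a : K)).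
by rewrite scalerDl scalerA.
Qed.

Fact scale_homog (K : fieldType) (V : superspace K) a b
    (c : scalar_superspace K) (y : V) :
  homog a c -> homog b y -> homog (a (+) b) ((c : K) *: y).
Proof.
case: a => [/(_ isT) ->|_] hy; last exact: homogZ.
by rewrite scale0r; apply: homog0.
Qed.

(** Tensor powers are nested to the right: T^0 = K, T^(n+1) = L (x) T^n. So L
    sits in T^1 = L (x) K through x |-> x (x) 1. *)
Section TensorAlgebra.
Context {K : fieldType} (L : superspace K).

Fixpoint tpow (n : nat) : superspace K :=
  if n is n'.+1 then stensor L (tpow n') else scalar_superspace K.

Fixpoint tpow_mul (m n : nat) : tpow m -> tpow n -> tpow (m + n)%N :=
  match m with
  | 0 => fun (c : K) y => c *: y
  | m'.+1 => fun x y => tlift (fun v t => tens v (tpow_mul t y)) x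
  end.

Lemma tpow_mul_bilinear m n : bilinear_map (@tpow_mul m n).
Proof.
elim: m => [|m IHm] /=.
  exact: scale_bilinear.
have B y : bilinear_map (fun (v : L) (t : tpow m) => tens v (@tpow_mul m n t y)).
  split=> [t c v v'|v c t t'] /=; first exact: (tens_bilinear _ _).1.
  have /= -> := IHm.1 y c t t'; exact: (tens_bilinear _ _).2.
split=> [y|x] /=; first exact: tlift_is_linear (B y).
pose g (z : tpow n) : tensor L (tpow m) -> tensor L (tpow (m + n)%N) :=
  tlift (fun v (t : tpow m) => tens v (tpow_mul t z)).
have gL z : linear (g z) := tlift_is_linear (B z).
move=> c y y'; rewrite -[LHS]/(g (c *: y + y') x) -[RHS]/(c *: g y x + g y' x).
move: x; apply: tensor_ind => [|x x' hx hx'|v t].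
- by rewrite !(lin0 (gL _)) scaler0 addr0.
- by rewrite !(linD (gL _)) hx hx' scalerDr addrACA.
rewrite /g !(tlift_tens (B _)).
have /= -> := IHm.2 t c y y'; exact: (tens_bilinear _ _).2.
Qed.

Lemma tpow_mul_tens m n (v : L) (t : tpow m) (y : tpow n) :
  @tpow_mul m.+1 n (tens v t) y = tens v (tpow_mul t y).
Proof.
apply: (tlift_tens (f := fun v (t : tpow m) => tens v (tpow_mul t y))).
split=> [s c v1 v2|v1 c s s']; first exact: (tens_bilinear _ _).1.
by rewrite ((tpow_mul_bilinear m n).1 y c s s'); exact: (tens_bilinear _ _).2.
Qed.

Lemma tpow_mul_homog m n a b (x : tpow m) (y : tpow n) :
  homog a x -> homog b y -> homog (a (+) b) (tpow_mul x y).
Proof.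
elim: m a x => [|m IHm] a x /= hx hy.
  exact: scale_homog.
have lin := (tpow_mul_bilinear m.+1 n).1 y.
apply: (span_ind (P := fun x => homog (a (+) b) (@tpow_mul m.+1 n x y)) _ _ hx).
  split=> [|c x1 x2 h1 h2].
    have -> : @tpow_mul m.+1 n 0 y = 0.
      exact: lin0 lin.
    exact: homog0.
  by rewrite (lin c x1 x2); apply: homogP2.
move=> _ [a1 [a2 [v [t [hv ht <- ->]]]]]; rewrite tpow_mul_tens.
apply: mem_span; exists a1, (a2 (+) b), v, (tpow_mul t y).
by split=> //; [apply: IHm | rewrite addbA].
Qed.

Lemma tpow_mul1x n (y : tpow n) : @tpow_mul 0 n (1 : K) y = y.
Proof. exact: scale1r. Qed.

Lemma dinj_tens (m n : nat) (e : m = n) (v : L) (s : tpow m) (t : tpow n) :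
  dinj (V := tpow) m s = dinj n t ->
  dinj (V := tpow) m.+1 (tens v s) = dinj n.+1 (tens v t).
Proof.
case: _ / e in t *; move=> st; congr dinj; congr tens.
have := congr1 (fun f : dsum tpow => f m) st.
by rewrite /= !dfwith_in.
Qed.

Lemma tpow_mulx1 m (x : tpow m) :
  dinj (V := tpow) (m + 0)%N (@tpow_mul m 0 x (1 : K)) = dinj m x.
Proof.
elim: m x => [|m IHm] x; first by congr dinj; exact: mulr1.
pose g (x : tpow m.+1) : dsum tpow :=
  dinj (V := tpow) (m.+1 + 0)%N (@tpow_mul m.+1 0 x (1 : K)).
have gL : linear g.
  by move=> c y y'; rewrite /g ((tpow_mul_bilinear m.+1 0).1 (1 : K) c y y') linearP.
rewrite -[LHS]/(g x); move: x; apply: tensor_ind => [|x x' hx hx'|v t].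
- by rewrite (lin0 gL) linear0.
- by rewrite (linD gL) linearD hx hx'.
by rewrite /g tpow_mul_tens; apply: dinj_tens; [exact: addn0 | exact: IHm].
Qed.

Definition tensor_alg : unital_superalgebra K :=
  @graded_alg K tpow tpow_mul tpow_mul_bilinear tpow_mul_homog (1 : K)
    tpow_mul1x tpow_mulx1.

Lemma tensor_algA : associative (@smul K tensor_alg).
Proof.
apply: (gmulA tpow_mul_bilinear); elim=> [|m IHm] n p x y z.
  congr dinj; apply/esym; have := (tpow_mul_bilinear n p).1 z x y 0.
  by rewrite (lin0 ((tpow_mul_bilinear n p).1 z)) !addr0.
pose g (x : tpow m.+1) : dsum tpow :=
  dinj (V := tpow) (m.+1 + (n + p))%N (@tpow_mul m.+1 (n + p)%N x (tpow_mul y z)).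
pose g' (x : tpow m.+1) : dsum tpow :=
  dinj (V := tpow) (m.+1 + n + p)%N
    (@tpow_mul (m.+1 + n)%N p (@tpow_mul m.+1 n x y) z).
have gL : linear g.
  by move=> c s t; rewrite /g ((tpow_mul_bilinear _ _).1 _ c s t) linearP.
have gL' : linear g'.
  move=> c s t; rewrite /g' ((tpow_mul_bilinear _ _).1 _ c s t).
  by rewrite ((tpow_mul_bilinear _ _).1 z c) linearP.
rewrite -[LHS]/(g x) -[RHS]/(g' x).
move: x; apply: tensor_ind => [|s t hs ht|v t].
- by rewrite (lin0 gL) (lin0 gL').
- by rewrite (linD gL) (linD gL') hs ht.
rewrite /g /g' !tpow_mul_tens.
by apply: dinj_tens; [exact: addnA | exact: IHm].
Qed.

Definition tensor_in (x : L) : tensor_alg := dinj (V := tpow) 1%N (tens (W := tpow 0) x (1 : K)).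

Lemma tensor_in_homog a (x : L) : homog a x -> homog a (tensor_in x).
Proof.
move=> hx; apply: dinj_homog; apply: mem_span; exists a, false, x, (1 : K).
by split; rewrite ?addbF.
Qed.

End TensorAlgebra.

Definition scast {K : fieldType} (V W : superspace K) (e : V = W) (x : V) : W :=
  match e in _ = U return superspace_sort U with erefl => x end.

Lemma scast_linear (K : fieldType) (V W : superspace K) (e : V = W) :
  linear (scast e).
Proof. by case: _ / e. Qed.

Lemma scast_homog (K : fieldType) (V W : superspace K) (e : V = W) a (x : V) :
  homog a x -> homog a (scast e x).
Proof. by case: _ / e. Qed.

Section NonassociativeTensorAlgebra.
Context {K : fieldType} (L : superspace K).

(** Strong recursion on n, with f >= n as fuel: the recursion equation of
    [ntpow n := ntpow_rec n n] is [ntpowSS], and the value for f = 0, n > 1 is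
    never used. *)
Fixpoint ntpow_rec (f n : nat) : superspace K :=
  match f, n with
  | _, 0 => scalar_superspace K
  | f'.+1, m.+2 => ssum (fun i : 'I_m.+1 =>
      stensor (ntpow_rec f' i.+1) (ntpow_rec f' (m.+1 - i)))
  | _, _ => L
  end.

Definition ntpow (n : nat) : superspace K := ntpow_rec n n.

Lemma ntpow_recE f n : (n <= f)%N -> ntpow_rec f n = ntpow n.
Proof.
have H k g h : (k <= g)%N -> (k <= h)%N -> ntpow_rec g k = ntpow_rec h k.
  elim: g k h => [|g IHg] [|[|k]] [|h] //= kg kh; congr ssum.
  apply: functional_extensionality_dep => i; congr stensor; apply: IHg.
  - by rewrite (leq_trans (ltn_ord i)).
  - by rewrite (leq_trans (ltn_ord i)).
  - by rewrite (leq_trans (leq_subr _ _)).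
  - by rewrite (leq_trans (leq_subr _ _)).
by move=> nf; apply: H.
Qed.

Lemma ntpow0 : ntpow 0 = scalar_superspace K. Proof. by []. Qed.
Lemma ntpow1 : ntpow 1 = L. Proof. by []. Qed.

Definition ntpow_summand (m : nat) (i : 'I_m.+1) : superspace K :=
  stensor (ntpow i.+1) (ntpow (m.+1 - i)).

(** T^n = (+)_(1 <= j <= n-1) T^j (x) T^(n-j), with n = m+2 and j = i+1. *)
Lemma ntpowSS m : ntpow m.+2 = ssum (@ntpow_summand m).
Proof.
rewrite -[LHS]/(ssum (fun i : 'I_m.+1 =>
  stensor (ntpow_rec m.+1 i.+1) (ntpow_rec m.+1 (m.+1 - i)))).
congr ssum; apply: functional_extensionality_dep => i.
by congr stensor; apply: ntpow_recE; [exact: ltn_ord | exact: leq_subr].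
Qed.

Fact ntpow_idx_lt (m n : nat) : (m < (m + n).+1)%N.
Proof. by rewrite ltnS leq_addr. Qed.
Fact ntpow_idx_sub (m n : nat) : n.+1 = ((m + n).+1 - m)%N.
Proof. by rewrite -addnS addnC addnK. Qed.
Fact ntpow_idx_add (m n : nat) : (m + n).+2 = (m.+1 + n.+1)%N.
Proof. by rewrite addSn addnS. Qed.

(** x (x) y, put in the summand of index j = m+1 of T^((m+1)+(n+1)); the casts
    are along equalities of degrees and along [ntpowSS]. *)
Definition ntpow_tens (m n : nat) (x : ntpow m.+1) (y : ntpow n.+1) :
    ntpow (m.+1 + n.+1)%N :=
  scast (congr1 ntpow (ntpow_idx_add m n)) (scast (esym (ntpowSS (m + n)))
    (dinj (V := @ntpow_summand (m + n)) (Ordinal (ntpow_idx_lt m n))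
      (tens x (scast (congr1 ntpow (ntpow_idx_sub m n)) y)))).

Definition ntpow_mul (m n : nat) : ntpow m -> ntpow n -> ntpow (m + n)%N :=
  match m, n with
  | 0, _ => fun (c : K) y => c *: y
  | m'.+1, 0 => fun x (c : K) => scast (congr1 ntpow (esym (addn0 m'.+1))) (c *: x)
  | m'.+1, n'.+1 => @ntpow_tens m' n'
  end.

Lemma ntpow_mul_bilinear m n : bilinear_map (@ntpow_mul m n).
Proof.
case: m n => [|m] [|n].
- exact: scale_bilinear.
- exact: scale_bilinear.
- split=> [a c x x'|x c a b] /=; rewrite -scast_linear; congr scast.
    by rewrite scalerDr !scalerA mulrC.
  by rewrite scalerDl scalerA.
split=> [y c x x'|x c y y'] /=; rewrite /ntpow_tens -!scast_linear;
  do 2!congr scast; rewrite -linearP; congr dinj.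
  exact: (tens_bilinear _ _).1.
by rewrite scast_linear; exact: (tens_bilinear _ _).2.
Qed.

Lemma ntpow_mul_homog m n a b (x : ntpow m) (y : ntpow n) :
  homog a x -> homog b y -> homog (a (+) b) (ntpow_mul x y).
Proof.
case: m n x y => [|m] [|n] x y hx hy.
- exact: scale_homog.
- exact: scale_homog.
- by apply: scast_homog; rewrite addbC; apply: scale_homog.
apply: scast_homog; apply: scast_homog; apply: dinj_homog; apply: mem_span.
exists a, b, x, (scast (congr1 ntpow (ntpow_idx_sub m n)) y).
by split=> //; apply: scast_homog.
Qed.

Lemma ntpow_mul1x n (y : ntpow n) : @ntpow_mul 0 n (1 : K) y = y.
Proof. exact: scale1r. Qed.

Lemma dinj_scast (m n : nat) (e : m = n) (x : ntpow m) :
  dinj (V := ntpow) n (scast (congr1 ntpow e) x) = dinj m x.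
Proof. by case: _ / e. Qed.

Lemma ntpow_mulx1 m (x : ntpow m) :
  dinj (V := ntpow) (m + 0)%N (@ntpow_mul m 0 x (1 : K)) = dinj m x.
Proof.
case: m x => [|m] x; first by congr dinj; exact: mulr1.
by rewrite [LHS]dinj_scast scale1r.
Qed.

Definition nonassoc_tensor_alg : unital_superalgebra K :=
  @graded_alg K ntpow ntpow_mul ntpow_mul_bilinear ntpow_mul_homog (1 : K)
    ntpow_mul1x ntpow_mulx1.

Definition nonassoc_tensor_in (x : L) : nonassoc_tensor_alg :=
  dinj (V := ntpow) 1%N x.

Lemma nonassoc_tensor_in_homog a (x : L) : homog a x -> homog a (nonassoc_tensor_in x).
Proof. by move=> hx; apply: dinj_homog. Qed.

End NonassociativeTensorAlgebra.

Section CommutatorRelations.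
Context {K : fieldType} {L : superalgebra K} {A : unital_superalgebra K} (j : L -> A).

(** x y - (-1)^(ab) y x - [x, y] for x in L_a and y in L_b; the bracket of L
    is its [smul]. *)
Definition commutator_rel : set A := fun r =>
  exists a b x y, [/\ homog a x, homog b y &
    r = smul (j x) (j y) - (-1) ^+ (a && b) *: smul (j y) (j x) - j (smul x y)].

(** (x y) z - x (y z) for x, y, z in L, not in the tensor algebra: the
    quotient need not be associative. *)
Definition associator_rel : set A := fun r =>
  exists a b c x y z, [/\ homog a x, homog b y, homog c z &
    r = smul (smul (j x) (j y)) (j z) - smul (j x) (smul (j y) (j z))].

Hypothesis j_homog : forall a x, homog a x -> homog a (j x).

Lemma commutator_rel_homog r : commutator_rel r -> exists a, homog a r.
Proof.
move=> [a [b [x [y [hx hy ->]]]]]; exists (a (+) b).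
have [jx jy] := (j_homog hx, j_homog hy).
apply: homogB; last by apply: j_homog; apply: smul_homog.
apply: homogB; first exact: smul_homog.
by apply: homogZ; rewrite addbC; apply: smul_homog.
Qed.

Lemma associator_rel_homog r : associator_rel r -> exists a, homog a r.
Proof.
move=> [a [b [c [x [y [z [hx hy hz ->]]]]]]]; exists (a (+) (b (+) c)).
have [jx jy jz] := And3 (j_homog hx) (j_homog hy) (j_homog hz).
apply: homogB; last by apply: smul_homog => //; apply: smul_homog.
by rewrite addbA; apply: smul_homog => //; apply: smul_homog.
Qed.
End CommutatorRelations.

Section Envelopes.
Context {K : fieldType} (L : lie_superalgebra K).

Definition lie_env_ideal : ideal (tensor_alg L) :=
  ideal_gen (commutator_rel (@tensor_in K L)).

Fact lie_env_ideal_graded : graded_sub lie_env_ideal.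
Proof.
by apply: ideal_gen_graded; apply: commutator_rel_homog; exact: tensor_in_homog.
Qed.

Definition lie_env : unital_superalgebra K := quot_alg lie_env_ideal_graded.
Definition lie_env_in (x : L) : lie_env := quot_map lie_env_ideal_graded (tensor_in x).

(** L is an Akivis superalgebra with A = 0, so the associator relations
    carry no term A(x, y, z). *)
Definition akivis_env_ideal : ideal (nonassoc_tensor_alg L) :=
  ideal_gen (commutator_rel (@nonassoc_tensor_in K L) `|`
             associator_rel (@nonassoc_tensor_in K L)).

Fact akivis_env_ideal_graded : graded_sub akivis_env_ideal.
Proof.
apply: ideal_gen_graded => r [].
  by apply: commutator_rel_homog; exact: nonassoc_tensor_in_homog.
by apply: associator_rel_homog; exact: nonassoc_tensor_in_homog.
Qed.

Definition akivis_env : unital_superalgebra K := quot_alg akivis_env_ideal_graded.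
Definition akivis_env_in (x : L) : akivis_env :=
  quot_map akivis_env_ideal_graded (nonassoc_tensor_in x).
End Envelopes.

(* Main.v *)
(** The nonassociative tensor algebra has the universal property that every
even linear map from L to a unital superalgebra B extends to a homomorphism. For
B = U(L) the extension of sigma kills the generators of I, the associators
because U(L) is associative, so it factors through the quotient by I.
Uniqueness holds because L generates the nonassociative tensor algebra, and
surjectivity because L generates the associative one; the isomorphism is then
the first isomorphism theorem. *)
Require Import Defs.
From mathcomp Require Import all_boot all_order all_algebra.
From mathcomp Require Import boolp classical_sets.

Set Implicit Arguments.
Unset Strict Implicit.
Unset Printing Implicit Defensive.
Local Open Scope ring_scope.
Import GRing.Theory.

(** * First isomorphism theorem and factorization through quotients *)

Lemma superhomZ (K : fieldType) (A B : unital_superalgebra K) (f : superhom A B) c x :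
  f (c *: x) = c *: f x.
Proof.
by rewrite -[c *: x]addr0 (superhom_linear f) (lin0 (superhom_linear f)) addr0.
Qed.

Lemma superhomB (K : fieldType) (A B : unital_superalgebra K) (f : superhom A B) x y :
  f (x - y) = f x - f y.
Proof. by rewrite addrC -scaleN1r (superhom_linear f) scaleN1r addrC. Qed.

(** The images of the components of [x] have the right parities and add up to [f x], so uniqueness
    of the decomposition applies. *)
Lemma scomp_superhom (K : fieldType) (A B : unital_superalgebra K)
  (f : superhom A B) a x : f (scomp a x) = scomp a (f x).
Proof.
rewrite {2}(scomp_sum x) (linD (superhom_linear f)).
have h b : homog b (f (scomp b x)) by apply/superhom_homog/scomp_homog.
by have [e0 e1] := scomp_uniq (h false) (h true); case: a.
Qed.

(** The isomorphism sends [u] to the class of a chosen preimage; its inverse applies [f] to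
    representatives. *)
Lemma surjective_superhom_iso (K : fieldType) (A B : unital_superalgebra K)
    (f : superhom A B) : (forall u, exists v, f v = u) ->
  superalg_iso B (quot_alg (ker_graded f)).
Proof.
move=> fS; pose g u : A := projT1 (cid (fS u)).
have gK u : f (g u) = u by rewrite /g; case: cid.
pose h u : quot_alg (ker_graded f) := quot_map (ker_graded f) (g u).
(* The choice of preimage is immaterial: two preimages of [f v] differ by an element of the kernel.
   The homomorphism laws of [h] all come from this. *)
have hE v : h (f v) = quot_map (ker_graded f) v.
  apply/lprojP/(mem_submod_of (ker_submod f)).
  by rewrite superhomB gK subrr.
have hL : linear h.
  move=> c x y; rewrite -{1}(gK x) -{1}(gK y) -(superhom_linear f) hE.
  exact: linearP.
have hM x y : h (smul x y) = smul (h x) (h y).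
  by rewrite -{1}(gK x) -{1}(gK y) -(superhom_mul f) hE /= quot_mul_proj.
have h1 : h sone = sone by rewrite -(superhom_one f) hE.
have hH a x : homog a x -> homog a (h x).
  (* The preimage [g x] need not be homogeneous, but its component of parity [a] is another preimage
     of [x]. *)
  move=> hx; exists (scomp a (g x)); split; first exact: scomp_homog.
  by rewrite -[RHS]/(quot_map (ker_graded f) (scomp a (g x))) -hE scomp_superhom gK scomp_id.
exists (Superhom hL hM h1 hH); exists (fun q => f (lrepr q)) => [u|q] /=.
  have /(mem_submod_of (ker_submod f)) : lrepr (h u) - g u \in ker f.
    exact: lrepr_proj.
  rewrite superhomB gK => /eqP.
  by rewrite subr_eq0 => /eqP.
by rewrite hE; exact: lreprK.
Qed.

(** Evaluating [f] on representatives is well defined, since representatives of one class differ by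
    an element of [J]. *)
Lemma quot_superhom (K : fieldType) (A B : unital_superalgebra K) (J : ideal A)
    (gJ : graded_sub J) (f : superhom A B) : (forall x, x \in J -> f x = 0) ->
  exists g : superhom (quot_alg gJ) B, forall x, g (quot_map gJ x) = f x.
Proof.
move=> fJ; pose g (q : quot_alg gJ) : B := f (lrepr q).
have gE x : g (quot_map gJ x) = f x.
  by apply/eqP; rewrite -subr_eq0 -superhomB fJ //; exact: lrepr_proj.
have gL : linear g.
  move=> c p q; rewrite -{1}(lreprK p) -{1}(lreprK q) -linearP.
  by rewrite [LHS]gE (superhom_linear f).
have gM p q : g (smul p q) = smul (g p) (g q).
  by rewrite -{1}(lreprK p) -{1}(lreprK q) /= quot_mul_proj [LHS]gE superhom_mul.
have g1 : g sone = sone by rewrite -(superhom_one f); exact: gE.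
have gH a p : homog a p -> homog a (g p).
  by move=> [x [hx ->]]; rewrite [g _]gE; apply: superhom_homog.
by exists (Superhom gL gM g1 gH).
Qed.

(** * Submodules and unital subalgebras as induction predicates *)

Lemma dsum_submod_ind (K : fieldType) (T : nat -> superspace K) (P : set (dsum T)) :
  submod P -> (forall n x, P (dinj n x)) -> forall x, P x.
Proof.
move=> [P0 PD] Pi; apply: dsum_ind => // f g Pf Pg.
by rewrite -[f]scale1r; apply: PD.
Qed.

(** Only closure properties are recorded, so that equalizers, images and preimages qualify without a
    parity argument. *)
Definition subalgebra (K : fieldType) (A : unital_superalgebra K) (P : set A) : Prop :=
  [/\ submod P, P sone & forall x y, P x -> P y -> P (smul x y)].

(** * Transport along equalities of superspaces *)

Section Scast.
Context {K : fieldType}.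

Lemma scast_id (V : superspace K) (e : V = V) x : scast e x = x.
Proof. by rewrite (Prop_irrelevance e erefl). Qed.

Lemma scast_trans (U V W : superspace K) (e1 : U = V) (e2 : V = W) x :
  scast e2 (scast e1 x) = scast (etrans e1 e2) x.
Proof. by case: _ / e2. Qed.

Lemma scast_esym (V W : superspace K) (e : V = W) x : scast e (scast (esym e) x) = x.
Proof. by case: _ / e x. Qed.

(** Moves a cast of a whole sum of tensor products onto the factors. Once the families are
    identified, every cast is the identity by proof irrelevance. *)
Lemma scast_dinj_tens (I : choiceType) (V V' W W' : I -> superspace K)
    (eV : forall i, V i = V' i) (eW : forall i, W i = W' i)
    (e : ssum (fun i => stensor (V i) (W i)) = ssum (fun i => stensor (V' i) (W' i)))
    i (u : V i) (v : W i) :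
  scast e (dinj (V := fun i => stensor (V i) (W i)) i (tens u v)) =
  dinj (V := fun i => stensor (V' i) (W' i)) i
    (tens (scast (eV i) u) (scast (eW i) v)).
Proof.
have EV : V = V' by apply: functional_extensionality_dep.
have EW : W = W' by apply: functional_extensionality_dep.
by subst V' W'; rewrite !scast_id.
Qed.

End Scast.

(** * Generation of both tensor algebras by L *)

Section Generation.
Context {K : fieldType} (L : superspace K).

(** Induction on the degree: since T^(n+1) = L (x) T^n, a pure tensor is a generator times an
    element of degree n. *)
Lemma tensor_alg_gen (P : set (tensor_alg L)) :
  subalgebra P -> (forall x : L, P (tensor_in x)) -> forall t, P t.
Proof.
move=> [[P0 PD] P1 PM] PL; apply: (@dsum_submod_ind K (tpow L)) => //.
elim=> [|n IHn] x.
  have -> : dinj (V := tpow L) 0%N x = (x : K) *: dinj (V := tpow L) 0%N (1 : K) + 0.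
    by rewrite addr0 -linearZ; congr dinj; rewrite /GRing.scale /= mulr1.
  by apply: PD.
move: x; apply: tensor_ind => [|x y Px Py|v t]; first by rewrite linear0.
  by rewrite linearD -[X in P (X + _)]scale1r; apply: PD.
have -> : dinj (V := tpow L) n.+1 (tens v t) =
      smul (tensor_in v : tensor_alg L) (dinj n t).
  rewrite /= gmul_inj; last exact: tpow_mul_bilinear.
  by rewrite (tpow_mul_tens (m := 0)) /= scale1r.
exact: PM.
Qed.

(** Strong induction on the degree: T^(m+2) is spanned by tensors whose two factors both have
    smaller degree. *)
Lemma nonassoc_tensor_alg_gen (P : set (nonassoc_tensor_alg L)) :
  subalgebra P -> (forall x : L, P (nonassoc_tensor_in x)) -> forall t, P t.
Proof.
move=> [[P0 PD] P1 PM] PL; apply: (@dsum_submod_ind K (ntpow L)) => //.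
elim/ltn_ind=> [[|[|m]]] IHm x; last first.
- rewrite -(scast_esym (esym (ntpowSS L m)) x).
  pose g y := dinj (V := ntpow L) m.+2 (scast (esym (ntpowSS L m)) y).
  have gL : linear g by move=> c y y'; rewrite /g scast_linear linearP.
  rewrite -[dinj _ _]/(g _); move: (scast _ x) => {x}.
  apply: dsum_ind => [|y z Py Pz|i].
  + by rewrite (lin0 gL).
  + by rewrite (linD gL) -[X in P (X + _)]scale1r; apply: PD.
  apply: tensor_ind => [|y z Py Pz|u v].
  + by rewrite linear0 (lin0 gL).
  + by rewrite linearD (linD gL) -[X in P (X + _)]scale1r; apply: PD.
  case: i u v => p lt_p /= u v.
  (* Summand [p] has factors of degrees p+1 and m+1-p. Writing m = p+k makes the second degree k+1,
     the form in which [ntpow_tens] builds products. *)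
  have [k def_m] : exists k, m = (p + k)%N.
    by exists (m - p)%N; rewrite subnKC.
  subst m; rewrite (bool_irrelevance lt_p (ntpow_idx_lt p k)).
  pose v' : ntpow L k.+1 := scast (esym (congr1 (ntpow L) (ntpow_idx_sub p k))) v.
  have -> : g (dinj (Ordinal (ntpow_idx_lt p k)) (tens u v)) =
      smul (dinj p.+1 u : nonassoc_tensor_alg L) (dinj k.+1 v').
    rewrite /= gmul_inj; last exact: ntpow_mul_bilinear.
    rewrite /= /ntpow_tens dinj_scast /g.
    by rewrite [scast _ v']scast_esym.
  apply: PM; apply: IHm; first by rewrite !ltnS leq_addr.
  by rewrite !ltnS leq_addl.
- exact: PL.
have -> : dinj (V := ntpow L) 0%N x = (x : K) *: dinj (V := ntpow L) 0%N (1 : K) + 0.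
  by rewrite addr0 -linearZ; congr dinj; rewrite /GRing.scale /= mulr1.
by apply: PD.
Qed.

End Generation.

(** Let e be the odd part of 1. For homogeneous x the product e x has the parity opposite to x, but
    also that of x, being x minus the even part of 1 times x. So e x = 0, and e = e 1 = 0. *)
Lemma homog_sone (K : fieldType) (A : unital_superalgebra K) : homog false (sone : A).
Proof.
set e := scomp true (sone : A).
have He a x : homog a x -> smul e x = 0.
  move=> hx; have := smul1x x; rewrite (scomp_sum sone) smulDl -/e => def_x.
  have h1 : homog (~~ a) (smul e x).
    by apply: (@smul_homog _ _ true) => //; apply: scomp_homog.
  have h0 : homog a (smul e x).
    rewrite (_ : smul e x = x - smul (scomp false sone) x).
      apply: homogB => //; apply: (@smul_homog _ _ false) => //; exact: scomp_homog.
    by rewrite -[X in X - _]def_x addrC addKr.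
  by case: a {hx} h0 h1 => h0 h1; apply: homog_direct.
have e0 : e = 0.
  rewrite -[e]smulx1 (scomp_sum sone) smulDr.
  by rewrite (He false) ?(He true) ?addr0 //; apply: scomp_homog.
by rewrite (scomp_sum sone) -/e e0 addr0; apply: scomp_homog.
Qed.

(** * Universal property of the nonassociative tensor algebra *)

Section Evaluation.
Context {K : fieldType} (L : superspace K) (B : unital_superalgebra K) (f : L -> B).
Hypotheses (fL : linear f) (fH : forall a x, homog a x -> homog a (f x)).

Definition mapped_superspace := {V : superspace K & V -> B}.

Definition eval_sum (n : nat) (F G : 'I_n -> mapped_superspace) : mapped_superspace :=
  existT (fun V : superspace K => V -> B)
    (ssum (fun i => stensor (projT1 (F i)) (projT1 (G i))))
    (dlift (fun i => tlift (fun x y => smul (projT2 (F i) x) (projT2 (G i) y)))).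

(** The evaluation map is bundled with its domain, so that its independence of
    the fuel is an equality in a single type. *)
Fixpoint eval_rec (g n : nat) : mapped_superspace :=
  match g, n with
  | _, 0 => existT (fun V : superspace K => V -> B)
              (scalar_superspace K) (fun c => (c : K) *: sone)
  | g'.+1, m.+2 => eval_sum (fun i : 'I_m.+1 => eval_rec g' i.+1)
                            (fun i => eval_rec g' (m.+1 - i))
  | _, _ => existT (fun V : superspace K => V -> B) L f
  end.

Lemma eval_recE g n : (n <= g)%N -> eval_rec g n = eval_rec n n.
Proof.
have H k p q : (k <= p)%N -> (k <= q)%N -> eval_rec p k = eval_rec q k.
  elim: p k q => [|p IHp] [|[|k]] [|q] //= kp kq.
  congr eval_sum; apply: functional_extensionality_dep => i; apply: IHp.
  - by rewrite (leq_trans (ltn_ord i)).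
  - by rewrite (leq_trans (ltn_ord i)).
  - by rewrite (leq_trans (leq_subr _ _)).
  - by rewrite (leq_trans (leq_subr _ _)).
by move=> nf; apply: H.
Qed.

Lemma eval_rec_dom g n : projT1 (eval_rec g n) = ntpow_rec L g n.
Proof.
elim: g n => [|g IHg] [|[|n]] //=; congr ssum.
by apply: functional_extensionality_dep => i; rewrite !IHg.
Qed.

(** The domain of [eval_rec n n] is identified with [ntpow L n] by the proof [eval_rec_dom], hence
    the cast. *)
Definition eval_pow (n : nat) (x : ntpow L n) : B :=
  projT2 (eval_rec n n) (scast (esym (eval_rec_dom n n)) x).

Definition even_linear (V : superspace K) (h : V -> B) : Prop :=
  linear h /\ forall a x, homog a x -> homog a (h x).

Lemma smul_tensor_bilinear (V W : superspace K) (h : V -> B) (k : W -> B) :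
  linear h -> linear k -> bilinear_map (fun x y => smul (h x) (k y)).
Proof.
move=> hL kL; split=> [y c x x'|x c y y'] /=; first by rewrite hL smulPl.
by rewrite kL smulPr.
Qed.

Lemma tlift_homog (V W : superspace K) (h : V -> B) (k : W -> B) :
  even_linear h -> even_linear k ->
  forall a (t : stensor V W), homog a t ->
    homog a (tlift (fun x y => smul (h x) (k y)) t).
Proof.
move=> [hL hH] [kL kH] a t.
have bil := smul_tensor_bilinear hL kL.
apply: (span_ind (P := fun t => homog a (tlift (fun x y => smul (h x) (k y)) t))).
  split=> [|c x y hx hy]; first by rewrite (lin0 (tlift_is_linear bil)); apply: homog0.
  by rewrite (tlift_is_linear bil); apply: homogP2.
move=> _ [a1 [a2 [v [w [hv hw <- ->]]]]]; rewrite (tlift_tens bil).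
by apply: smul_homog; [apply: hH | apply: kH].
Qed.

Lemma dlift_even_linear (I : choiceType) (V : I -> superspace K)
    (h : forall i, V i -> B) :
  (forall i, even_linear (h i)) -> even_linear (V := ssum V) (dlift h).
Proof.
move=> hE; split=> [|a x hx]; first by apply: dlift_is_linear => i; case: (hE i).
rewrite /dlift; apply: (big_ind (fun y : B => homog a y)) => [||i _].
- exact: homog0.
- by move=> *; apply: homogD.
by case: (hE i) => _; apply; apply: hx.
Qed.

(** Degree 0 maps c to c times the unit, which is even by [homog_sone]. *)
Lemma eval_rec_even_linear g n : even_linear (projT2 (eval_rec g n)).
Proof.
have H0 : even_linear (V := scalar_superspace K) (fun c => (c : K) *: (sone : B)).
  split=> [c x y|[] x hx]; first by rewrite scalerDl scalerA.
    by rewrite (hx isT) scale0r; apply: homog0.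
  exact/homogZ/homog_sone.
elim: g n => [|g IHg] [|[|n]] //.
apply: dlift_even_linear => i; split; last exact: tlift_homog.
by apply/tlift_is_linear/smul_tensor_bilinear; [case: (IHg i.+1)|case: (IHg (n.+1 - i)%N)].
Qed.

Lemma eval_pow_even_linear n : even_linear (@eval_pow n).
Proof.
have [EL EH] := eval_rec_even_linear n n.
split=> [c x y|a x hx]; rewrite /eval_pow; first by rewrite scast_linear EL.
by apply: EH; apply: scast_homog.
Qed.

(** Extracts from an equality of bundled maps an equality of values, up to a cast of the domain. *)
Lemma mapped_superspace_eq (p q : mapped_superspace) (e : projT1 q = projT1 p) x :
  p = q -> projT2 p (scast e x) = projT2 q x.
Proof. by move=> pq; subst p; rewrite scast_id. Qed.

Lemma eval_pow0 (c : K) : eval_pow (n := 0) c = c *: sone.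
Proof. by rewrite /eval_pow scast_id. Qed.

Lemma eval_pow1 (x : L) : eval_pow (n := 1) x = f x.
Proof. by rewrite /eval_pow scast_id. Qed.

(** The recursion equation of evaluation. The unfolded recursion gives both factors fuel m+1;
    [eval_recE] brings each fuel down to the degree of its factor. *)
Lemma eval_powSS m (i : 'I_m.+1) (u : ntpow L i.+1) (v : ntpow L (m.+1 - i)) :
  eval_pow (scast (esym (ntpowSS L m))
    (dinj (V := @ntpow_summand K L m) i (tens u v))) =
  smul (eval_pow u) (eval_pow v).
Proof.
pose F (i : 'I_m.+1) := eval_rec i.+1 i.+1.
pose G (i : 'I_m.+1) := eval_rec (m.+1 - i) (m.+1 - i).
have ES : eval_rec m.+2 m.+2 = eval_sum F G.
  rewrite -[LHS]/(eval_sum (fun j : 'I_m.+1 => eval_rec m.+1 j.+1)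
                           (fun j => eval_rec m.+1 (m.+1 - j))).
  congr eval_sum; apply: functional_extensionality_dep => j.
    by apply: eval_recE; apply: ltn_ord.
  by apply: eval_recE; apply: leq_subr.
have eS : ntpow L m.+2 = projT1 (eval_sum F G).
  by rewrite -ES eval_rec_dom.
have eE : projT1 (eval_sum F G) = projT1 (eval_rec m.+2 m.+2) by rewrite ES.
(* The cast is split at the domain of [eval_sum F G], so that [ES] can replace the bundled map. *)
rewrite {1}/eval_pow (Prop_irrelevance (esym (eval_rec_dom _ _)) (etrans eS eE)).
rewrite -scast_trans (mapped_superspace_eq _ _ ES) scast_trans.
rewrite (scast_dinj_tens (V := fun i : 'I_m.+1 => ntpow L i.+1)
  (W := fun i : 'I_m.+1 => ntpow L (m.+1 - i))
  (V' := fun i => projT1 (F i)) (W' := fun i => projT1 (G i))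
  (fun i => esym (eval_rec_dom i.+1 i.+1))
  (fun i => esym (eval_rec_dom (m.+1 - i) (m.+1 - i)))).
have bil j : bilinear_map (fun x y => smul (projT2 (F j) x) (projT2 (G j) y)).
  apply: smul_tensor_bilinear; first by case: (eval_rec_even_linear j.+1 j.+1).
  by case: (eval_rec_even_linear (m.+1 - j) (m.+1 - j)).
rewrite [LHS]dlift_inj ?(tlift_tens (bil i)) // => j.
exact: tlift_is_linear (bil j).
Qed.

Lemma eval_pow_scast m n (e : m = n) x :
  eval_pow (scast (congr1 (ntpow L) e) x) = eval_pow x.
Proof. by case: _ / e. Qed.

(** In degree 0 the product is a scaling and the unit laws of [B] apply; otherwise it is one tensor
    in one summand, covered by [eval_powSS]. *)
Lemma eval_pow_mul m n (x : ntpow L m) (y : ntpow L n) :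
  eval_pow (ntpow_mul x y) = smul (eval_pow x) (eval_pow y).
Proof.
have eZ k c (z : ntpow L k) : eval_pow (c *: z) = c *: eval_pow z.
  have [EL _] := eval_pow_even_linear k.
  by rewrite -[c *: z]addr0 EL (lin0 EL) addr0.
case: m n x y => [|m] [|n] x y.
- by rewrite [LHS]eZ !eval_pow0 smulZl smul1x.
- by rewrite [LHS]eZ eval_pow0 smulZl smul1x.
- by rewrite eval_pow_scast eZ eval_pow0 smulZr smulx1.
rewrite /= /ntpow_tens eval_pow_scast eval_powSS; congr smul.
exact: eval_pow_scast.
Qed.

(** The degreewise evaluations are added up; bilinearity reduces multiplicativity to factors of a
    single degree. *)
Lemma nonassoc_tensor_alg_lift : exists F : superhom (nonassoc_tensor_alg L) B,
  forall x, F (nonassoc_tensor_in x) = f x.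
Proof.
pose F : nonassoc_tensor_alg L -> B := dlift (V := ntpow L) eval_pow.
have EL n : linear (@eval_pow n) by case: (eval_pow_even_linear n).
have [FL FH] : even_linear F by apply: dlift_even_linear => n; apply: eval_pow_even_linear.
have Fi n x : F (dinj (V := ntpow L) n x) = eval_pow x by rewrite /F dlift_inj.
have F1 : F sone = sone by rewrite [LHS]Fi eval_pow0 scale1r.
have FM x y : F (smul x y) = smul (F x) (F y).
  move: x; refine (@dsum_submod_ind K (ntpow L) 
    (fun x : nonassoc_tensor_alg L => F (smul x y) = smul (F x) (F y)) _ _).
    split=> [|c u v hu hv]; first by rewrite smul0l (lin0 FL) smul0l.
    by rewrite smulPl !FL smulPl hu hv.
  move=> m x; move: y.
  apply: (@dsum_submod_ind K (ntpow L)
    (fun y => F (smul (dinj m x : nonassoc_tensor_alg L) y) = smul (F (dinj m x)) (F y))).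
    split=> [|c u v hu hv]; first by rewrite smul0r (lin0 FL) smul0r.
    by rewrite smulPr !FL smulPr hu hv.
  move=> n y; rewrite [smul _ _ in LHS]gmul_inj; last exact: ntpow_mul_bilinear.
  by rewrite !Fi eval_pow_mul.
exists (Superhom FL FM F1 FH) => x; rewrite [LHS]Fi; exact: eval_pow1.
Qed.

End Evaluation.

(** * Equalizers, images and generators of quotients *)

Section Homomorphisms.
Context {K : fieldType}.

(** Reduces uniqueness of a homomorphism to agreement on generators. *)
Lemma superhom_eq_subalgebra (A B : unital_superalgebra K) (f g : superhom A B) :
  subalgebra (fun x => f x = g x).
Proof.
split=> [||x y fx fy]; last by rewrite !superhom_mul fx fy.
  split=> [|c x y fx fy].
    by rewrite (lin0 (superhom_linear f)) (lin0 (superhom_linear g)).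
  by rewrite (superhom_linear f) (superhom_linear g) fx fy.
by rewrite !superhom_one.
Qed.

Lemma quot_mapP (A : unital_superalgebra K) (J : ideal A) (gJ : graded_sub J) c x y :
  quot_map gJ (c *: x + y) = c *: quot_map gJ x + quot_map gJ y.
Proof. exact: linearP. Qed.

Lemma quot_map_mul (A : unital_superalgebra K) (J : ideal A) (gJ : graded_sub J) x y :
  quot_map gJ (smul x y) = smul (quot_map gJ x) (quot_map gJ y).
Proof. by rewrite /= quot_mul_proj. Qed.

Lemma quot_map_superhom (A : unital_superalgebra K) (J : ideal A) (gJ : graded_sub J) :
  exists p : superhom A (quot_alg gJ), p =1 quot_map gJ.
Proof.
have pH a x : homog a x -> homog a (quot_map gJ x) by move=> hx; exists x.
by exists (Superhom (quot_mapP gJ) (quot_map_mul gJ) erefl pH).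
Qed.

Lemma preim_subalgebra (A B : unital_superalgebra K) (p : superhom A B) (P : set B) :
  subalgebra P -> subalgebra (fun x => P (p x)).
Proof.
move=> [[P0 PD] P1 PM]; split=> [||x y px py].
- split=> [|c x y px py]; first by rewrite (lin0 (superhom_linear p)).
  by rewrite (superhom_linear p); apply: PD.
- by rewrite superhom_one.
by rewrite superhom_mul; apply: PM.
Qed.

(** The preimage of a subalgebra under the projection is a subalgebra containing [S], hence
    everything. *)
Lemma quot_alg_gen (A : unital_superalgebra K) (J : ideal A) (gJ : graded_sub J)
    (S : set A) :
  (forall P : set A, subalgebra P -> (forall x, S x -> P x) -> forall x, P x) ->
  forall P : set (quot_alg gJ), subalgebra P ->
    (forall x, S x -> P (quot_map gJ x)) -> forall q, P q.
Proof.
move=> gen P PA PS q; have [p pE] := quot_map_superhom gJ.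
rewrite -(lreprK q); have := gen _ (preim_subalgebra p PA).
by move=> /(_ _ (lrepr q)); rewrite pE; apply=> x Sx; rewrite pE; apply: PS.
Qed.

(** Reduces surjectivity to reaching the generators. *)
Lemma im_subalgebra (A B : unital_superalgebra K) (f : superhom A B) :
  subalgebra (fun u => exists v, f v = u).
Proof.
split=> [||_ _ [x <-] [y <-]]; last by exists (smul x y); apply: superhom_mul.
  split=> [|c _ _ [x <-] [y <-]]; first by exists 0; apply: lin0; apply: superhom_linear.
  by exists (c *: x + y); apply: superhom_linear.
by exists sone; apply: superhom_one.
Qed.

End Homomorphisms.

(** * The homomorphism between the two envelopes *)

Section LieEnvelope.
Context {K : fieldType} (L : lie_superalgebra K).

(** Inherited from the tensor algebra through representatives. *)
Lemma lie_env_smulA : associative (@smul K (lie_env L)).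
Proof.
have qK t : quot_map (@lie_env_ideal_graded K L) (lrepr t) = t by exact: lreprK.
move=> p q r; rewrite -(qK p) -(qK q) -(qK r).
by rewrite /lie_env -!quot_map_mul tensor_algA.
Qed.

Lemma tensor_in_linear : linear (@tensor_in K L).
Proof.
move=> c x y; rewrite /tensor_in -linearP; congr dinj.
by have := (tens_bilinear L (tpow L 0)).1 (1 : K) c x y.
Qed.

Lemma lie_env_in_linear : linear (@lie_env_in K L).
Proof. by move=> c x y; rewrite /lie_env_in tensor_in_linear quot_mapP. Qed.

Lemma lie_env_in_homog a (x : L) : homog a x -> homog a (lie_env_in x).
Proof. by move=> hx; exists (tensor_in x); split=> //; apply: tensor_in_homog. Qed.

(** The left-hand side is the class of a generator of [lie_env_ideal]. *)
Lemma lie_env_in_commutator a b (x y : L) : homog a x -> homog b y ->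
  smul (lie_env_in x) (lie_env_in y)
    - (-1) ^+ (a && b) *: smul (lie_env_in y) (lie_env_in x)
    - lie_env_in (smul x y) = 0.
Proof.
move=> hx hy; have [p pE] := quot_map_superhom (@lie_env_ideal_graded K L).
rewrite /lie_env_in -!pE -!(superhom_mul p).
rewrite -superhomZ -!superhomB pE; apply/lproj_eq0/mem_ideal_gen.
by exists a, b, x, y.
Qed.

Lemma akivis_env_hom : exists st : superhom (akivis_env L) (lie_env L),
  forall x : L, st (akivis_env_in x) = lie_env_in x.
Proof.
have [F FE] := nonassoc_tensor_alg_lift lie_env_in_linear lie_env_in_homog.
have [|st stE] := quot_superhom (@akivis_env_ideal_graded K L) (f := F); last first.
  by exists st => x; rewrite stE FE.
move=> x xI; apply/(mem_submod_of (ker_submod F)).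
(* The kernel of [F] is an ideal, so only the generators need to be checked. *)
apply: (ideal_gen_min (J := ker F)) xI => r rel_r.
apply/(mem_submod_of (ker_submod F)).
case: rel_r => [[a [b [y [z [hy hz ->]]]]]|[a [b [c [y [z [t [_ _ _ ->]]]]]]]].
  by rewrite !superhomB superhomZ !superhom_mul !FE lie_env_in_commutator.
by rewrite superhomB !superhom_mul !FE lie_env_smulA subrr.
Qed.

End LieEnvelope.

Theorem mainTheorem4 (K : fieldType)
    (char2 : 2%N \notin [pchar K]) (char3 : 3%N \notin [pchar K])
    (L : lie_superalgebra K) :
  exists st : superhom (akivis_env L) (lie_env L),
    [/\ forall x : L, st (akivis_env_in x) = lie_env_in x,
        forall s : superhom (akivis_env L) (lie_env L),
          (forall x : L, s (akivis_env_in x) = lie_env_in x) -> s =1 st,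
        forall u : lie_env L, exists v : akivis_env L, st v = u
      & superalg_iso (lie_env L) (quot_alg (ker_graded st))].
Proof.
have [st stE] := akivis_env_hom L.
have stS u : exists v, st v = u.
  apply: (quot_alg_gen (S := range (@tensor_in K L)) _ (im_subalgebra st)).
    move=> P PA PS; apply: tensor_alg_gen => // x.
    by apply: PS; exists x.
  by move=> _ [x _ <-]; exists (akivis_env_in x); apply: stE.
exists st; split=> //; last exact: surjective_superhom_iso.
(* The equalizer of [s] and [st] is a subalgebra containing the image of L. *)
move=> s sE; apply: (quot_alg_gen (S := range (@nonassoc_tensor_in K L)) _
  (superhom_eq_subalgebra s st)).
  move=> P PA PS; apply: nonassoc_tensor_alg_gen => // x.
  by apply: PS; exists x.
by move=> _ [x _ <-]; rewrite [LHS]sE [RHS]stE.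
Qed.
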